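(* Let $k\ge1$ be an integer. There exists a constant $c$ depending only on $k$ such that for every $\Phi>0$ there is a function $g_{\Phi,k}:(0,\infty)\to\mathbb{R}$ with $\lim_{R\to+\infty}g_{\Phi,k}(R)/R=0$ such that, for every $1$-Lipschitz function $f:\mathbb{N}\to\mathbb{R}$ and all $R>0$, $$\rho_\Phi\big(f\ge\mathbb{E}_{\rho_\Phi}(f)+R\big)\le\exp\Big(-(k+1)R\log R+[\log\Phi+c]\,R+g_{\Phi,k}(R)\Big).$$
   Context: $\mathbb{N}=\{0,1,2,\dots\}$. The measure $\rho_\Phi$ on $\mathbb{N}$ is defined as follows. Let $j_k,j_{-1}>0$ and let $\mathbb{P}^0$ be the law of the continuous-time random walk on $\mathbb{Z}$ over the time interval $[0,1]$, started at $0$, that jumps from $z$ to $z+k$ at rate $j_k$ and from $z$ to $z-1$ at rate $j_{-1}$, for every $z\in\mathbb{Z}$. Let $N^k$ and $N^{-1}$ be the numbers of jumps of size $+k$ and $-1$ during $[0,1]$; under $\mathbb{P}^0$ they are independent Poisson variables with parameters $j_k$ and $j_{-1}$. Set $\Phi:=j_{-1}^k\,j_k$. Then $$\rho_\Phi(\cdot)=\mathbb{P}^{0}\big(N^k\in\cdot\ \big|\ kN^k-N^{-1}=0\big),$$ i.e. $\rho_\Phi$ is the law of $N^k$ under the bridge from $0$ to $0$; it depends on $(j_k,j_{-1})$ only through $\Phi$. A function $f:\mathbb{N}\to\mathbb{R}$ is $1$-Lipschitz if $|f(n+1)-f(n)|\le1$ for all $n$. *)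

(* Defs.v *)
From HB Require Import structures.
From mathcomp Require Import all_boot all_order all_algebra.
From mathcomp Require Import finmap.
From mathcomp Require Import all_classical all_reals all_analysis.

Set Implicit Arguments.
Unset Strict Implicit.
Unset Printing Implicit Defensive.

Import Order.TTheory GRing.Theory Num.Theory.
Import numFieldNormedType.Exports.

Local Open Scope classical_set_scope.
Local Open Scope ring_scope.

Section jumps.
Context d (T : measurableType d) (R : realType).
Implicit Type X : R -> T -> int.

(* For integer-valued paths, "X jumps by h at time u" says that the increment
   X u - X v is constantly h for v < u close enough to u. *)
Definition jump_times X (h : int) (s t : R) (w : T) : set R :=
  [set u | s < u <= t /\ \forall v \near u^'-, X u w - X v w = h].

(* [fset_set] is empty on infinite sets; the paths of [random_walk] below have
   left and right limits on [0, 1], hence finitely many jumps. *)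
Definition njumps X (h : int) (s t : R) (w : T) : nat :=
  #|` fset_set (jump_times X h s t w)|%fset.

End jumps.

(* The continuous-time random walk on [0, 1] started at 0 that, from every z,
   jumps to z + k at rate jk and to z - 1 at rate jm1, realised on (T, P).
   The values of [walk] outside the time interval [0, 1] are irrelevant.
   The rates are constant in space and time, so having them means that the
   counting processes of the two kinds of jumps are independent Poisson
   processes of intensities jk and jm1; [walk_rates] states this through the
   joint law of their increments along arbitrary subdivisions. *)
Record random_walk d (T : measurableType d) (R : realType)
    (P : probability T R) (k : nat) (jk jm1 : R) := RandomWalk {
  walk :> R -> T -> int ;
  walk_start : forall w, walk 0 w = 0 ;
  walk_right_continuous : forall w t, 0 <= t < 1 ->
    \forall s \near t^'+, walk s w = walk t w ;
  walk_jumps : forall w t, 0 < t <= 1 ->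
    exists2 h : int, h \in [:: 0; k%:Z; - 1] &
      \forall s \near t^'-, walk t w - walk s w = h ;
  walk_measurable : forall t z, 0 <= t <= 1 ->
    measurable [set w | walk t w = z] ;
  njumps_measurable : forall h s t, 0 <= s -> s < t -> t <= 1 ->
    measurable_fun setT (njumps walk h s t) ;
  walk_rates : forall (m : nat) (t : nat -> R) (a b : nat -> nat),
    0 <= t 0%N -> (forall i, (i < m)%N -> t i < t i.+1) -> t m <= 1 ->
    P [set w | forall i, (i < m)%N ->
         njumps walk k%:Z (t i) (t i.+1) w = a i /\
         njumps walk (- 1) (t i) (t i.+1) w = b i] =
    (\prod_(i < m) (poisson_pmf (jk * (t i.+1 - t i)) (a i) *
                    poisson_pmf (jm1 * (t i.+1 - t i)) (b i)))%:E }.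

Section bridge.
Context d (T : measurableType d) (R : realType) (P : probability T R).
Context (k : nat) (jk jm1 : R) (X : random_walk P k jk jm1).

Definition up_jumps : T -> nat := njumps X k%:Z 0 1.
Definition down_jumps : T -> nat := njumps X (- 1) 0 1.

Lemma measurable_up_jumps : measurable_fun setT up_jumps.
Proof. by apply: (njumps_measurable X). Qed.

Lemma measurable_down_jumps : measurable_fun setT down_jumps.
Proof. by apply: (njumps_measurable X). Qed.

HB.instance Definition _ :=
  isMeasurableFun.Build _ _ _ _ up_jumps measurable_up_jumps.

Definition bridge_event : set T :=
  [set w | k%:Z * (up_jumps w)%:Z - (down_jumps w)%:Z = 0].

Lemma measurable_bridge_event : measurable bridge_event.
Proof.
have -> : bridge_event =
    \bigcup_n (up_jumps @^-1` [set n] `&` down_jumps @^-1` [set (k * n)%N]).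
  apply/seteqP; split => [w /eqP|w [n _ [/= Hn Hm]]].
    by rewrite subr_eq0 -PoszM => /eqP[E]; exists (up_jumps w).
  by rewrite /bridge_event /= Hn Hm PoszM subrr.
apply: bigcup_measurable => n _; apply: measurableI.
- by rewrite -[X in measurable X]setTI; apply: measurable_up_jumps.
- by rewrite -[X in measurable X]setTI; apply: measurable_down_jumps.
Qed.

(* P conditioned on [bridge_event]: A |-> P (A `&` bridge_event) / P bridge_event.
   The last argument of [mnormalize] is only used if P bridge_event = 0, which
   does not happen when jk and jm1 are positive. *)
Definition bridge : probability T R :=
  mnormalize (mrestr P measurable_bridge_event) P.

Definition rho : probability nat R := distribution bridge up_jumps.

End bridge.

(* Main.v *)
Require Import Defs.
From mathcomp Require Import all_boot all_order all_algebra.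
From mathcomp Require Import all_classical all_reals all_analysis.
From mathcomp Require Import ring lra.

Import Order.TTheory GRing.Theory Num.Theory.
Import numFieldNormedType.Exports.

Local Open Scope classical_set_scope.
Local Open Scope ring_scope.

(** The law [rho] gives to [n] a mass proportional to
    [Phi ^ n / (n! (k n)!)], the product of the Poisson weights of [n] jumps up
    and [k * n] jumps down.  The normalising factor is at least the term
    [n = 0], that is [1], so the mass of [n] is at most
    [Phi ^ n / (n! (k n)!)] ([rho_set1_le]).  Everything else uses this bound
    on the point masses alone, so it is uniform in the rates and in the
    underlying probability space.

    If [e ^ s * Phi = y * z ^ k], then [e ^ (s n)] times the bound is
    [(y ^ n / n!) * (z ^ (k n) / (k n)!)], where the second factor is at most
    [e ^ z] and the first one sums to [e ^ y]; hence
    [E (e ^ (s N)) <= e ^ (y + z)] ([integral_expR_le]).  With [s = 1],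
    [y = e * Phi] and [z = 1] this gives [E N <= M] for a constant [M]
    depending on [Phi] only.  A 1-Lipschitz [f] satisfies
    [f n <= f 0 + n] and [E f >= f 0 - E N], so [f n >= E f + r] forces
    [n >= r - M] ([lipschitz_deviation_sub]).

    It remains to bound the upper tail of [N].  The Chernoff bound with
    [y = z = r], so that [e ^ s = r ^ (k + 1) / Phi], reads
    [P (N >= r - M) <= e ^ (2 r - s (r - M))].  Since
    [s = (k + 1) ln r - ln Phi], the exponent is
    [- (k + 1) r ln r + (ln Phi + 2) r + M s], whose last term is logarithmic
    in [r].  Thus [c = 2] and [g r = M |s|]; the absolute value covers the
    small [r] for which [s <= 0], where the right-hand side is at least [1]
    ([lipschitz_deviation_le]). *)

(** * Partial sums of the exponential and integrals over the integers *)

Lemma sum_exp_coeff_le_expR {R : realType} {y : R} (n : nat) : 0 <= y ->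
  \sum_(0 <= i < n) y ^+ i / i`!%:R <= expR y.
Proof.
move=> y0; apply: (@nondecreasing_cvgn_le R (series (exp_coeff y))).
  by apply: nondecreasing_series => i _ _; exact: exp_coeff_ge0.
exact: is_cvg_series_exp_coeff.
Qed.

Lemma exp_coeff_le_expR {R : realType} {y : R} (n : nat) : 0 <= y ->
  y ^+ n / n`!%:R <= expR y.
Proof.
move=> y0; apply: le_trans (sum_exp_coeff_le_expR n.+1 y0).
rewrite big_nat_recr//= lerDr; apply: sumr_ge0 => i _.
exact: exp_coeff_ge0.
Qed.

Lemma measurable_fun_nat {d : measure_display} {T : measurableType d}
  (h : nat -> T) : measurable_fun setT h.
Proof. by []. Qed.

Lemma ge0_integral_nat {R : realType} (mu : {measure set nat -> \bar R})
    (h : nat -> R) : (forall n, 0 <= h n) ->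
  (\int[mu]_n (h n)%:E = \sum_(n <oo) (h n)%:E * mu [set n])%E.
Proof.
move=> h0.
have -> : [set: nat] = \bigcup_n [set n].
  by apply/seteqP; split => // n _; exists n.
rewrite ge0_integral_bigcup//; last 2 first.
- by move=> x _; rewrite lee_fin.
- by move=> i j _ _ [x [/= <- <-]].
apply: eq_eseriesr => n _.
rewrite (eq_integral (cst (h n)%:E)) ?integral_cst// => x.
by rewrite inE => ->.
Qed.

(** The exponential moment bound below at the parameter [1], with the choice
    [y = e * Phi], [z = 1]; its use is that it depends on [Phi] only. *)
Definition mean_bound {R : realType} (Phi : R) : R := expR (expR 1 * Phi + 1).

(** * Deviations under a law with small point masses *)

Section bridge_law.
Context {R : realType} {k : nat} {Phi : R} {Q : probability nat R}.
Hypothesis Phi_gt0 : 0 < Phi.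
Hypothesis Q_le :
  forall n, (Q [set n] <= (Phi ^+ n / (n`!%:R * (k * n)`!%:R))%:E)%E.

(** The point masses are controlled by a product of two exponential series
    taken along the same index.  Two free parameters [y] and [z] are kept since
    [y = z] is the efficient choice for large deviations, whereas [z = 1] is
    available for every [s]. *)
Lemma integral_expR_le {s y z : R} : 0 <= y -> 0 <= z ->
  expR s * Phi = y * z ^+ k ->
  (\int[Q]_n (expR (s * n%:R))%:E <= (expR (y + z))%:E)%E.
Proof.
move=> y0 z0 syz.
rewrite ge0_integral_nat; last by move=> n; exact: expR_ge0.
apply: lime_le.
  by apply: is_cvg_nneseries => n _ _; rewrite mule_ge0// lee_fin expR_ge0.
apply: nearW => n.
apply: (@le_trans _ _ (\sum_(0 <= i < n) (y ^+ i / i`!%:R * expR z)%:E)%E).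
  apply: lee_sum => i _.
  apply: (@le_trans _ _
    ((expR (s * i%:R))%:E * (Phi ^+ i / (i`!%:R * (k * i)`!%:R))%:E)%E).
    by rewrite lee_pmul2l ?lte_fin ?expR_gt0// Q_le.
  rewrite -EFinM lee_fin expRM_natr.
  have -> : expR s ^+ i * (Phi ^+ i / (i`!%:R * (k * i)`!%:R)) =
      y ^+ i / i`!%:R * (z ^+ (k * i) / (k * i)`!%:R).
    by rewrite mulrA -exprMn syz exprMn -exprM invfM mulrACA.
  apply: ler_wpM2l; first exact: exp_coeff_ge0.
  exact: exp_coeff_le_expR.
rewrite sumEFin lee_fin -mulr_suml expRD ler_wpM2r ?expR_ge0//.
exact: sum_exp_coeff_le_expR.
Qed.

Lemma integral_id_le : (\int[Q]_n (n%:R)%:E <= (mean_bound Phi)%:E)%E.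
Proof.
apply: (@le_trans _ _ (\int[Q]_n (expR (1 * n%:R))%:E)%E); last first.
  apply: integral_expR_le => //; last by rewrite expr1n mulr1.
  by rewrite mulr_ge0 ?expR_ge0// ltW.
apply: ge0_le_integral => //.
by move=> n _; rewrite lee_fin mul1r (le_trans _ (expR_ge1Dx _))// lerDr.
Qed.

Lemma integrable_id : Q.-integrable setT (fun n => (n%:R : R)%:E).
Proof.
apply/integrableP; split => //.
under eq_integral do rewrite gee0_abs ?lee_fin//.
exact: le_lt_trans integral_id_le (ltry _).
Qed.

Section lipschitz.
Context {f : nat -> R}.
Hypothesis f_lip : forall n, `|f n.+1 - f n| <= 1.

Lemma lipschitz_dist0 n : `|f n - f 0%N| <= n%:R.
Proof.
elim: n => [|n IHn]; first by rewrite subrr normr0.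
rewrite -(subrKA (f n)) -natr1 addrC (le_trans (ler_normD _ _))//.
exact: lerD.
Qed.

Lemma integrable_lipschitz : Q.-integrable setT (EFin \o f).
Proof.
apply: (@le_integrable _ _ _ _ _ _ _ (fun n => (`|f 0%N| + n%:R)%:E)) => //.
- move=> n _ /=; rewrite lee_fin [leRHS]ger0_norm ?addr_ge0//.
  rewrite -[f n](subrK (f 0%N)) addrC (le_trans (ler_normD _ _))//.
  by rewrite lerD2l lipschitz_dist0.
under eq_fun do rewrite EFinD.
apply: integrableD => //; last exact: integrable_id.
exact: finite_measure_integrable_cst.
Qed.

Lemma expectation_lipschitz_ge : ((f 0%N - mean_bound Phi)%:E <= 'E_Q[f])%E.
Proof.
apply: (@le_trans _ _ (\int[Q]_n ((f 0%N)%:E - (n%:R)%:E))%E).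
  rewrite integralB//; [|exact: finite_measure_integrable_cst|
                         exact: integrable_id].
  rewrite integral_cst// EFinB; apply: leeB; last exact: integral_id_le.
  rewrite [X in (_ * X)%E](_ : _ = 1%E) ?mule1//; exact: probability_setT.
rewrite unlock; apply: le_integral.
- exact: measurableT.
- apply: integrableB => //; first exact: finite_measure_integrable_cst.
  exact: integrable_id.
- exact: integrable_lipschitz.
- move=> n _; rewrite -EFinB lee_fin lerBlDr -lerBlDl.
  by rewrite (le_trans (ler_norm _))// distrC lipschitz_dist0.
Qed.

(** Comparing both [f n] and the mean of [f] with [f 0] turns a large deviation
    of [f] into a large deviation of the identity, at the cost of shifting the
    threshold by a constant. *)
Lemma lipschitz_deviation_sub (r : R) :
  [set n | ('E_Q[f] + r%:E <= (f n)%:E)%E] `<=`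
  [set n | r - mean_bound Phi <= n%:R].
Proof.
move=> n /= fn.
have : ((f 0%N - mean_bound Phi)%:E + r%:E <= (f n)%:E)%E.
  by apply: le_trans fn; rewrite leeD2r// expectation_lipschitz_ge.
rewrite -EFinD lee_fin => h.
have := le_trans (ler_norm _) (lipschitz_dist0 n).
lra.
Qed.

(** Chernoff bound for the identity at the parameter [s] such that
    [expR s * Phi = r ^ (k + 1)], the order of magnitude that minimises
    [2 * y - s * r] under [expR s * Phi = y ^ (k + 1)].  That bound needs
    [0 < s]; otherwise the exponent is nonnegative and the claim is trivial. *)
Lemma lipschitz_deviation_le (r s : R) : 0 < r ->
  s = k.+1%:R * ln r - ln Phi ->
  (Q [set n | ('E_Q[f] + r%:E <= (f n)%:E)%E] <=
   (expR (- (r * s) + 2 * r + mean_bound Phi * `|s|))%:E)%E.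
Proof.
move=> r0 sE.
have M0 : 0 <= mean_bound Phi by exact: expR_ge0.
have [s0|s0] := leP s 0.
  apply: (@le_trans _ _ 1%E); first exact: probability_le1.
  rewrite lee_fin -expR0 ler_expR ler_wpDr ?mulr_ge0//.
  by rewrite addr_ge0// ?oppr_ge0 ?mulr_ge0_le0 ?mulr_ge0// ltW.
have sPhi : expR s * Phi = r * r ^+ k.
  rewrite sE expRB lnK ?posrE// divfK ?gt_eqF// expRM_natl lnK ?posrE//.
  by rewrite exprS.
pose N : {RV Q >-> R} :=
  mfun_Sub (mem_set (measurable_fun_nat (fun n => n%:R : R))).
apply: (@le_trans _ _ (Q [set n | r - mean_bound Phi <= N n])).
  by apply: le_measure; rewrite ?inE//; exact: lipschitz_deviation_sub.
apply: le_trans (chernoff N (r - mean_bound Phi) s0) _.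
have -> : - (r * s) + 2 * r + mean_bound Phi * `|s| =
    r + r + - (s * (r - mean_bound Phi)) by rewrite gtr0_norm//; ring.
rewrite expRD EFinM lee_wpmul2r ?lee_fin ?expR_ge0//.
rewrite /mmt_gen_fun unlock.
rewrite (eq_integral (fun n => (expR (s * n%:R))%:E)) => [|n _]; last first.
  by rewrite /= mulrC.
by apply: integral_expR_le => //; exact: ltW.
Qed.

End lipschitz.
End bridge_law.

(** * Point masses of the bridge law *)

Lemma mnormalize_fin {d : measure_display} {T : measurableType d}
    {R : realType} (mu : {measure set T -> \bar R}) (P : probability T R)
    (A : set T) : mu setT != 0%E -> mu setT \is a fin_num ->
  mnormalize mu P A = (mu A * (fine (mu setT))^-1%:E)%E.
Proof.
move=> mu0 mufin; rewrite /mnormalize (negbTE mu0) /= ifF//.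
by apply/negP => /eqP muoo; rewrite muoo in mufin.
Qed.

Section rho_weights.
Context {d} {T : measurableType d} {R : realType} {P : probability T R}.
Context {k : nat} {jk jm1 : R} (X : random_walk P k jk jm1).

(** The rates give the joint law of the increments along any subdivision; here
    the subdivision is trivial. *)
Lemma joint_jumps_law (a b : nat) :
  P [set w | up_jumps X w = a /\ down_jumps X w = b] =
  (poisson_pmf jk a * poisson_pmf jm1 b)%:E.
Proof.
have := walk_rates X (m := 1) (t := fun i => i%:R) (fun=> a) (fun=> b).
rewrite big_ord1 /= subr0 !mulr1 => <- //.
- congr (P _); apply/seteqP; split => w /= h; last exact: (h 0%N).
  by case.
- by move=> i _; rewrite ltr_nat.
Qed.

Hypotheses (jk_gt0 : 0 < jk) (jm1_gt0 : 0 < jm1).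

(** The conditioning event contains the event of no jump at all, whose
    probability is exactly the common factor [expR (- jk - jm1)] of the Poisson
    weights, so that dividing by its probability can only absorb that factor. *)
Lemma rho_set1_le (n : nat) :
  (rho X [set n] <=
   ((jm1 ^+ k * jk) ^+ n / (n`!%:R * (k * n)`!%:R))%:E)%E.
Proof.
have E : up_jumps X @^-1` [set n] `&` bridge_event X =
    [set w | up_jumps X w = n /\ down_jumps X w = (k * n)%N].
  apply/seteqP; split => w /=.
    move=> [un /eqP]; rewrite un subr_eq0 -PoszM => /eqP[dn].
    by split.
  by move=> [un dn]; split => //; rewrite /bridge_event /= un dn PoszM subrr.
have Z_ge : ((expR (- jk - jm1))%:E <= P (bridge_event X))%E.
  have -> : (expR (- jk - jm1))%:E =
      P [set w | up_jumps X w = 0%N /\ down_jumps X w = 0%N].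
    rewrite joint_jumps_law /poisson_pmf jk_gt0 jm1_gt0 !expr0 fact0 invr1.
    by rewrite !mul1r -expRD.
  have sub : [set w | up_jumps X w = 0%N /\ down_jumps X w = 0%N] `<=`
      bridge_event X.
    by move=> w /= [u0 d0]; rewrite /bridge_event /= u0 d0 mulr0 subrr.
  have -> : [set w | up_jumps X w = 0%N /\ down_jumps X w = 0%N] =
      up_jumps X @^-1` [set 0%N] `&` down_jumps X @^-1` [set 0%N] by [].
  apply: le_measure => //; rewrite inE.
    apply: measurableI; rewrite -[X in measurable X]setTI.
      exact: measurable_up_jumps.
    exact: measurable_down_jumps.
  exact: measurable_bridge_event.
have Z_fin : P (bridge_event X) \is a fin_num.
  by apply: fin_num_measure; exact: measurable_bridge_event.
have Z_gt0 : (0 < P (bridge_event X))%E.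
  by apply: lt_le_trans Z_ge; rewrite lte_fin expR_gt0.
have -> : rho X [set n] =
    (P (up_jumps X @^-1` [set n] `&` bridge_event X) *
     (fine (P (bridge_event X)))^-1%:E)%E.
  have := @mnormalize_fin _ _ _ (mrestr P (measurable_bridge_event X)) P
    (up_jumps X @^-1` [set n]).
  rewrite /= /mrestr setTI => -> //.
  by rewrite gt_eqF.
rewrite E joint_jumps_law -EFinM lee_fin.
rewrite /poisson_pmf jk_gt0 jm1_gt0.
rewrite ler_pdivrMr ?fine_gt0 ?Z_gt0 ?ltey_eq ?Z_fin//.
have -> : jk ^+ n / n`!%:R * expR (- jk) *
    (jm1 ^+ (k * n) / (k * n)`!%:R * expR (- jm1)) =
    (jm1 ^+ k * jk) ^+ n / (n`!%:R * (k * n)`!%:R) * expR (- jk - jm1).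
  by rewrite exprMn -exprM expRD invfM; ring.
apply: ler_wpM2l; last by rewrite -lee_fin fineK.
by rewrite divr_ge0 ?mulr_ge0 ?exprn_ge0 ?mulr_ge0 ?exprn_ge0// ltW.
Qed.

End rho_weights.

(** * Negligibility of the logarithmic correction *)

(** The bound [ln u < u] is too weak at [u = r], but at [u = sqrt r] it gives
    [ln r < 2 * sqrt r]. *)
Lemma cvg_ln_div (R : realType) : ln r / r @[r --> +oo] --> (0 : R).
Proof.
apply/cvgr0Pnorm_lt => e e0.
near=> r.
have r1 : 1 < r by near: r; exact: nbhs_pinfty_gt (num_real _).
have r0 : 0 < r by exact: lt_trans r1.
set u := Num.sqrt r.
have u0 : 0 < u by rewrite sqrtr_gt0.
have ur : u ^+ 2 = r by rewrite sqr_sqrtr// ltW.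
have eu : 2 / e < u.
  rewrite -(ltr_pXn2r (n := 2)) ?nnegrE ?divr_ge0 ?ltW// ur.
  by near: r; exact: nbhs_pinfty_gt (num_real _).
rewrite ger0_norm; last by rewrite divr_ge0 ?ln_ge0// ltW.
rewrite ltr_pdivrMr// -ur lnXn//.
rewrite ltr_pdivrMr// in eu.
have := ln_sublinear u0.
rewrite mulr2n; nra.
Unshelve. all: by end_near. Qed.

Lemma cvg_affine_ln_div (R : realType) (a b M : R) :
  M * `|a * ln r - b| / r @[r --> +oo] --> (0 : R).
Proof.
have -> : (0 : R) = M * `|a * 0 - b * 0| by rewrite !mulr0 subr0 normr0 mulr0.
apply: (@cvg_trans _ (M * `|a * (ln r / r) - b * r^-1| @[r --> +oo])).
  apply: near_eq_cvg; near=> r.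
  have r0 : 0 < r by near: r; exact: nbhs_pinfty_gt (num_real _).
  by rewrite mulrA -mulrBl normrM [`|r^-1|]gtr0_norm ?invr_gt0// mulrA.
apply: cvgM; first exact: cvg_cst.
apply: cvg_norm; apply: cvgB; apply: cvgM.
- exact: cvg_cst.
- exact: cvg_ln_div.
- exact: cvg_cst.
- apply/gtr0_cvgV0; last exact: cvg_id.
  exact: nbhs_pinfty_gt (num_real _).
Unshelve. all: by end_near. Qed.

Theorem theorem3p1 (R : realType) (k : nat) (hk : (1 <= k)%N) :
  exists c : R, forall Phi : R, 0 < Phi ->
  exists g : R -> R,
    (g r / r @[r --> +oo] --> (0 : R)) /\
    forall (d : measure_display) (T : measurableType d) (P : probability T R)
      (jk jm1 : R) (X : random_walk P k jk jm1),
      0 < jk -> 0 < jm1 -> Phi = jm1 ^+ k * jk ->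
    forall f : nat -> R, (forall n, `|f n.+1 - f n| <= 1) ->
    forall r : R, 0 < r ->
      (rho X [set n | ('E_(rho X)[f] + r%:E <= (f n)%:E)%E] <=
       (expR (- (k.+1)%:R * r * ln r + (ln Phi + c) * r + g r))%:E)%E.
Proof.
exists 2 => Phi Phi0.
exists (fun r => mean_bound Phi * `|k.+1%:R * ln r - ln Phi|); split.
  exact: cvg_affine_ln_div.
move=> d T P jk jm1 X jk0 jm10 PhiE f f_lip r r0.
have Q_le n : (rho X [set n] <=
    (Phi ^+ n / (n`!%:R * (k * n)`!%:R))%:E)%E.
  by rewrite PhiE; exact: rho_set1_le.
have -> : - (k.+1)%:R * r * ln r + (ln Phi + 2) * r +
    mean_bound Phi * `|k.+1%:R * ln r - ln Phi| =
    - (r * (k.+1%:R * ln r - ln Phi)) + 2 * r +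
    mean_bound Phi * `|k.+1%:R * ln r - ln Phi| by ring.
exact: lipschitz_deviation_le.
Qed.
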